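(* Fix an equation $(f,q,w)$ as in the context with $\prod_{i=0}^{N-1}(1/f_i)>0$. Let $\gamma\in(-\pi,0)\cup(0,\pi)$ and $K=(k_{ij})\in SL(2,\mathbb R)$ with $k_{11}-f_0k_{12}\neq0$. Let $\mathbf U_K=\begin{pmatrix}k_{11}&k_{12}&0&0\\0&0&1&0\end{pmatrix}$. For $M\in\{K,-K\}$ with entries $m_{ij}$, write $\lambda_j(M)$, $\lambda_j(-M)$, $\lambda_j(e^{i\gamma}M)$, $\lambda_j(\mathbf U_K)$ for the eigenvalues with boundary conditions $[M|-I]$, $[-M|-I]$, $[e^{i\gamma}M|-I]$, $\mathbf U_K$, and put $m_j=\min\{\lambda_j(M),\lambda_j(-M)\}$, $M_j=\max\{\lambda_j(M),\lambda_j(-M)\}$. If $m_{11}-f_0m_{12}>0$, then for every $0\le j\le N-1$: $\lambda_j(M)<\lambda_j(e^{i\gamma}M)<\lambda_j(-M)$ if $j$ is even and $\lambda_j(-M)<\lambda_j(e^{i\gamma}M)<\lambda_j(M)$ if $j$ is odd; and $M_j\le\lambda_j(\mathbf U_K)\le m_{j+1}$ for $0\le j\le N-2$.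
   Context: Let $N\ge2$ be an integer. An equation is given by real sequences $f=\{f_n\}_{n=0}^N$, $q=\{q_n\}_{n=1}^N$, $w=\{w_n\}_{n=1}^N$ with $f_n\neq0$, $w_n>0$; it is $-\nabla(f_n\Delta y_n)+q_ny_n=\lambda w_ny_n$, $1\le n\le N$, for $y=\{y_n\}_{n=0}^{N+1}$, $\Delta y_n=y_{n+1}-y_n$, $\nabla y_n=y_n-y_{n-1}$. A boundary condition $[A\,|\,B]$ (equivalently the $2\times4$ coefficient matrix $(A,B)$ of rank 2) is $A(y_0,f_0\Delta y_0)^T+B(y_N,f_N\Delta y_N)^T=0$; matrices differing by left multiplication by an invertible $2\times2$ complex matrix give the same condition (so $\mathbf U_{-K}=\mathbf U_K$). $SL(2,\mathbb R)$: real $2\times2$ matrices of determinant 1; $I$ the identity. Eigenvalues ($\lambda$ with a nontrivial solution) are real; multiplicity = dimension of the solution space; counted with multiplicity they are ordered $\lambda_0\le\lambda_1\le\cdots$. *)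

(* Defs.v *)
From mathcomp Require Import all_boot all_order all_algebra.
From mathcomp Require Import reals trigo complex.
Set Implicit Arguments. Unset Strict Implicit. Unset Printing Implicit Defensive.
Import Order.TTheory GRing.Theory Num.Theory.
Local Open Scope ring_scope.
Local Open Scope complex_scope.

(* A (complex) sequence y = (y_0, ..., y_{N+1}) is a row vector of length N+2;
   [yat y n] is y_n. *)
Definition yat (R : realType) (N : nat) (y : 'rV[R[i]]_(N.+2)) (n : nat) : R[i] :=
  y 0 (inord n).

Definition Dy (R : realType) (N : nat) (y : 'rV[R[i]]_(N.+2)) (n : nat) : R[i] :=
  yat y n.+1 - yat y n.

(* residual of  -nabla(f_n Delta y_n) + q_n y_n - lambda w_n y_n  at n (1 <= n <= N) *)
Definition sl_resid (R : realType) (N : nat) (f q w : nat -> R) (lam : R[i])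
  (y : 'rV[R[i]]_(N.+2)) (n : nat) : R[i] :=
  - ((f n)%:C * Dy y n - (f n.-1)%:C * Dy y n.-1)
  + (q n)%:C * yat y n - lam * (w n)%:C * yat y n.

Definition bvec (R : realType) (N : nat) (f : nat -> R) (y : 'rV[R[i]]_(N.+2))
  (n : nat) : 'cV[R[i]]_2 :=
  \col_(k < 2) (if k == 0 :> nat then yat y n else (f n)%:C * Dy y n).

Definition bc_resid (R : realType) (N : nat) (f : nat -> R) (A B : 'M[R[i]]_2)
  (y : 'rV[R[i]]_(N.+2)) : 'cV[R[i]]_2 :=
  A *m bvec f y 0 + B *m bvec f y N.

(* all residuals collected in one vector: entries 0..N-1 are the equations at
   n = 1..N, entries N, N+1 are the two rows of the boundary condition. *)
Definition resid (R : realType) (N : nat) (f q w : nat -> R) (A B : 'M[R[i]]_2)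
  (lam : R[i]) (y : 'rV[R[i]]_(N.+2)) : 'rV[R[i]]_(N.+2) :=
  \row_(j < N.+2) (if (j < N)%N then sl_resid f q w lam y j.+1
                   else bc_resid f A B y (inord (j - N)) 0).

Definition is_solution (R : realType) (N : nat) (f q w : nat -> R)
  (A B : 'M[R[i]]_2) (lam : R[i]) (y : 'rV[R[i]]_(N.+2)) : Prop :=
  resid f q w A B lam y = 0.

(* multiplicity of lam = dimension of the (complex) solution space
   {y | resid y = 0} = kernel of the linear map resid (as a matrix);
   it is 0 iff lam is not an eigenvalue. *)
Definition mult (R : realType) (N : nat) (f q w : nat -> R) (A B : 'M[R[i]]_2)
  (lam : R[i]) : nat :=
  \rank (kermx (lin1_mx (@resid R N f q w A B lam))).

(* s is the nondecreasing list of all eigenvalues of [A|B], each repeated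
   according to its multiplicity; then s`_j = lambda_j. *)
Definition ev_list (R : realType) (N : nat) (f q w : nat -> R) (A B : 'M[R[i]]_2)
  (s : seq R) : Prop :=
  sorted <=%R s /\
  forall z : R[i], count (fun x : R => x%:C == z) s = mult N f q w A B z.

Definition cmx (R : realType) (M : 'M[R]_2) : 'M[R[i]]_2 :=
  map_mx (fun x : R => x%:C) M.

Definition expi (R : realType) (g : R) : R[i] := (cos g)%:C + 'i * (sin g)%:C.

(* U_K = ( k11 k12 0 0 ; 0 0 1 0 ), i.e. A = (k11 k12; 0 0), B = (0 0; 1 0) *)
Definition UK_A (R : realType) (K : 'M[R]_2) : 'M[R[i]]_2 :=
  \matrix_(i < 2, j < 2) (if i == 0 :> nat then (K 0 j)%:C else 0).
Definition UK_B (R : realType) : 'M[R[i]]_2 :=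
  \matrix_(i < 2, j < 2) (if (i == 1 :> nat) && (j == 0 :> nat) then 1 else 0).

(* Main.v *)
From HB Require Import structures.
Require Import Defs.
From mathcomp Require Import all_boot all_order all_algebra.
From mathcomp Require Import perm sesquilinear spectral ring.
From mathcomp Require Import reals trigo complex.
Set Implicit Arguments. Unset Strict Implicit. Unset Printing Implicit Defensive.
Import Order.TTheory GRing.Theory Num.Theory.
Local Open Scope ring_scope.
Local Open Scope complex_scope.

(** Since m_11 - f_0 m_12 is nonzero, the boundary condition [z M | -I], |z| = 1, expresses
    y_0 and y_(N+1) through y_1 and y_N.  What remains is the pencil H_z - lambda W, with W
    the diagonal matrix of the weights and H_z a Hermitian periodic Jacobi matrix whose
    corners are proportional to z and its conjugate.  U_K leads in the same way to the
    leading principal submatrix of H_z, which does not depend on z: Cauchy interlacing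
    bounds its eigenvalues by those of H_z, and shows that the j-th eigenvalue for one z
    never passes the (j+1)-st for another.  Expanding the determinant in the two corners,
    det (H_z - x W) = g(x) - 2 k Re z with k independent of x and z, and k > 0 because the
    product of the f_i is positive.  So at a j-th eigenvalue for one z the characteristic
    polynomial for another z has the sign of the difference of the real parts, whereas
    between its (j-1)-st and j-th roots it has sign (-1)^j; this forces the alternating
    order. *)

Lemma rank_diag_mx (F : fieldType) (n : nat) (d : 'rV[F]_n) :
  \rank (diag_mx d) = #|[pred i | d 0 i != 0]|.
Proof.
rewrite -sum1_card big_mkcond /=.
elim: n d => [|n IHn] d; first by rewrite big_ord0 flatmx0 mxrank0.
rewrite big_ord_recl; change 'rV[F]_(1 + n) in d.
have -> : diag_mx d = block_mx (d 0 ord0)%:M 0 0 (diag_mx (rsubmx d)).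
  rewrite -{1}[d]hsubmxK diag_mx_row; congr block_mx.
  by rewrite [LHS]mx11_scalar !mxE eqxx mulr1n lshift0.
have /= -> := rank_diag_block_mx ((d 0 ord0)%:M : 'M_1) (diag_mx (rsubmx d)).
rewrite IHn; congr (_ + _)%N; last first.
  by apply: eq_bigr => i _; rewrite !inE mxE rshift1.
rewrite inE; have [->|nz] := eqVneq; first by rewrite raddf0 mxrank0.
by rewrite -scalemx1 mxrank_scale_nz // mxrank1.
Qed.

Lemma exists_common_vector (F : fieldType) (m1 m2 n : nat)
    (A : 'M[F]_(m1, n)) (B : 'M[F]_(m2, n)) :
  (n < \rank A + \rank B)%N ->
  exists v : 'rV_n, [/\ v != 0, (v <= A)%MS & (v <= B)%MS].
Proof.
move=> lt_n; have /rowV0Pn[v] : (A :&: B)%MS != 0.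
  rewrite -mxrank_eq0 -lt0n -(ltn_add2l (\rank (A + B))) addn0.
  by rewrite mxrank_sum_cap (leq_ltn_trans (rank_leq_col _)).
by rewrite sub_capmx => /andP[vA vB] v_neq0; exists v.
Qed.

Section HermitianEigenvalues.
Variable R : rcfType.
Local Notation C := R[i].
Local Open Scope sesquilinear_scope.
Local Notation "''[' u , v ]" := (dotmx u v) : ring_scope.
Local Notation "''[' u ]" := '[u, u] : ring_scope.

Lemma hermsymmxE (n : nat) (S : 'M[C]_n) : (S \is hermsymmx) = (S == S ^t*).
Proof. by rewrite is_hermitianmxE scale1r. Qed.

Lemma hermsymmxP (n : nat) (S : 'M[C]_n) :
  reflect (forall i j, S i j = Num.conj (S j i)) (S \is hermsymmx).
Proof.
rewrite hermsymmxE; apply: (iffP idP) => [/eqP eS i j|eS].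
  by rewrite {1}eS !mxE.
by apply/eqP/matrixP => i j; rewrite !mxE; exact: eS.
Qed.

Lemma dotmx_mull (m n : nat) (u : 'rV[C]_m) (v : 'rV[C]_n) (A : 'M[C]_(m, n)) :
  '[u *m A, v] = '[u, v *m A ^t*].
Proof. by rewrite !dotmxE trmx_mul map_mxM trmxCK mulmxA. Qed.

Lemma dotmx_unitary (m n : nat) (P : 'M[C]_(m, n)) (u v : 'rV[C]_m) :
  P \is unitarymx -> '[u *m P, v *m P] = '[u, v].
Proof. by move=> Pu; rewrite dotmx_mull mulmxtVK. Qed.

Lemma dotmx_unitary_conj (n : nat) (U : 'M[C]_n) (d v : 'rV[C]_n) :
  U \is unitarymx ->
  '[v *m U *m (U ^t* *m diag_mx d *m U), v *m U] = \sum_i d 0 i * `|v 0 i| ^+ 2.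
Proof.
move=> Uu; rewrite !mulmxA mulmxtVK // dotmx_unitary // dotmxE mul_mx_diag mxE.
by apply: eq_bigr => i _; rewrite !mxE normCK mulrAC mulrC.
Qed.

Lemma dotmx_normE (n : nat) (v : 'rV[C]_n) : '[v] = \sum_i `|v 0 i| ^+ 2.
Proof.
by rewrite dotmxE mxE; apply: eq_bigr => i _; rewrite !mxE normCK.
Qed.

(* Junk unless [S] is Hermitian: only then is [spectral_diag S] real. *)
Definition eigenvals (n : nat) (S : 'M[C]_n) : seq R :=
  sort <=%R [seq complex.Re (spectral_diag S 0 i) | i : 'I_n].

Definition eigenvals_row (n : nat) (S : 'M[C]_n) : 'rV[C]_n :=
  \row_i ((eigenvals S)`_i)%:C.

Lemma eigenvals_sorted (n : nat) (S : 'M[C]_n) : sorted <=%R (eigenvals S).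
Proof. exact: sort_le_sorted. Qed.

Lemma size_eigenvals (n : nat) (S : 'M[C]_n) : size (eigenvals S) = n.
Proof. by rewrite size_sort size_map -cardE card_ord. Qed.

Lemma le_eigenvals (n : nat) (S : 'M[C]_n) (i j : nat) :
  (i <= j)%N -> (j < n)%N -> (eigenvals S)`_i <= (eigenvals S)`_j.
Proof.
move=> le_ij lt_jn; apply: (sorted_leq_nth le_trans le_refl 0 (eigenvals_sorted S)) => //.
  by rewrite inE size_eigenvals (leq_ltn_trans le_ij).
by rewrite inE size_eigenvals.
Qed.

Lemma hermitian_diagonalization (n : nat) (S : 'M[C]_n) : S \is hermsymmx ->
  exists2 U : 'M[C]_n, U \is unitarymx &
    S = U ^t* *m diag_mx (eigenvals_row S) *m U.
Proof.
move=> S_herm; have Vu := spectral_unitarymx S.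
have /mxOverP d_real := hermitian_spectral_diag_real S_herm.
have /orthomx_spectralP := hermitian_normalmx S_herm.
rewrite invmx_unitary // => eS.
pose t : n.-tuple R := [tuple complex.Re (spectral_diag S 0 i) | i < n].
have /tuple_permP[p ep] : perm_eq (eigenvals S) t by rewrite perm_sort.
exists (row_perm p (spectralmx S)).
  apply/row_unitarymxP => i j; rewrite !row_permEsub !row_rowsub -(inj_eq (@perm_inj _ p)).
  exact: (row_unitarymxP Vu).
rewrite {1}eS; apply/matrixP => i j; rewrite !mul_mx_diag !mxE.
rewrite (reindex_perm p) /=; apply: eq_bigr => k _; rewrite !mxE ep.
by rewrite nth_mktuple tnth_mktuple RRe_real.
Qed.

Lemma unitary_conj_sub_scalar (n : nat) (S U : 'M[C]_n) (d : 'rV[C]_n) (z : C) :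
  U \is unitarymx -> S = U ^t* *m diag_mx d *m U ->
  S - z%:M = invmx U *m diag_mx (d - const_mx z) *m U.
Proof.
move=> Uu ->; rewrite linearB /= diag_const_mx mulmxBr mulmxBl invmx_unitary //.
congr (_ - _); rewrite mul_mx_scalar -scalemxAl -invmx_unitary //.
by rewrite mulVmx ?unitarymx_unit // scalemx1.
Qed.

Lemma count_eigenvals (n : nat) (S : 'M[C]_n) (z : C) : S \is hermsymmx ->
  count (fun x : R => x%:C == z) (eigenvals S) = \rank (kermx (S - z%:M)).
Proof.
move=> /hermitian_diagonalization[U Uu eS]; have Uunit := unitarymx_unit Uu.
rewrite (unitary_conj_sub_scalar z Uu eS) mxrank_ker.
rewrite mxrankMfree ?row_free_unit // (eqmxMfull _ (_ : row_full (invmx U))); last first.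
  by rewrite row_full_unit unitmx_inv.
rewrite rank_diag_mx; set nonzero := [pred i | _].
rewrite -[X in (X - _)%N]card_ord -(cardC nonzero) addKn -sum1_count (big_nth 0).
rewrite size_eigenvals big_mkord -sum1_card.
by apply: eq_bigl => i; rewrite !inE negbK !mxE subr_eq0.
Qed.

Lemma det_eigenvals (n : nat) (S : 'M[C]_n) (z : C) : S \is hermsymmx ->
  \det (S - z%:M) = \prod_(i < n) (((eigenvals S)`_i)%:C - z).
Proof.
move=> /hermitian_diagonalization[U Uu eS].
rewrite (unitary_conj_sub_scalar z Uu eS) !det_mulmx mulrAC -det_mulmx.
rewrite mulVmx ?unitarymx_unit // det1 mul1r det_diag.
by apply: eq_bigr => i _; rewrite !mxE.
Qed.

Lemma low_eigenspace (n : nat) (S : 'M[C]_n) (j : nat) : S \is hermsymmx -> (j < n)%N ->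
  exists2 W : 'M[C]_n, \rank W = j.+1 & forall v : 'rV_n, (v <= W)%MS ->
    '[v *m S, v] <= ((eigenvals S)`_j)%:C * '[v].
Proof.
move=> /hermitian_diagonalization[U Uu eS] lt_jn; exists (pid_mx j.+1 *m U).
  by rewrite mxrankMfree ?row_free_unit ?unitarymx_unit // rank_pid_mx.
move=> _ /submxP[c ->]; rewrite mulmxA [in X in '[_ *m X, _]]eS dotmx_unitary_conj //.
rewrite dotmx_unitary // dotmx_normE mulr_sumr; apply: ler_sum => i _; rewrite mxE.
have [lt_ji|le_ij] := ltnP j i; last by rewrite ler_wpM2r ?exprn_ge0 // lecR le_eigenvals.
suff -> : (c *m pid_mx j.+1) 0 i = 0 by rewrite normr0 expr0n !mulr0.
rewrite mxE big1 // => k _; rewrite mxE; case: eqP => [->|_]; last by rewrite mulr0.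
by rewrite ltnS leqNgt lt_ji mulr0.
Qed.

Lemma high_eigenspace (n : nat) (S : 'M[C]_n) (j : nat) : S \is hermsymmx -> (j < n)%N ->
  exists2 W : 'M[C]_n, \rank W = (n - j)%N & forall v : 'rV_n, (v <= W)%MS ->
    ((eigenvals S)`_j)%:C * '[v] <= '[v *m S, v].
Proof.
move=> /hermitian_diagonalization[U Uu eS] lt_jn; exists (copid_mx j *m U).
  by rewrite mxrankMfree ?row_free_unit ?unitarymx_unit // rank_copid_mx // ltnW.
move=> _ /submxP[c ->]; rewrite mulmxA [in X in _ <= '[_ *m X, _]]eS dotmx_unitary_conj //.
rewrite dotmx_unitary // dotmx_normE mulr_sumr; apply: ler_sum => i _.
rewrite [X in _ <= X * _]mxE.
have [lt_ij|le_ji] := ltnP i j; last by rewrite ler_wpM2r ?exprn_ge0 // lecR le_eigenvals.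
suff -> : (c *m copid_mx j) 0 i = 0 by rewrite normr0 expr0n !mulr0.
rewrite mxE big1 // => k _; rewrite !mxE (val_eqE k i).
by case: eqP => [->|_]; rewrite ?lt_ij ?andbF subrr mulr0.
Qed.

Lemma courant_fischer_upper (m n : nat) (S : 'M[C]_n) (W : 'M[C]_(m, n)) (j : nat) (a : R) :
  S \is hermsymmx -> (j < \rank W)%N ->
  (forall v : 'rV_n, (v <= W)%MS -> '[v *m S, v] <= a%:C * '[v]) ->
  (eigenvals S)`_j <= a.
Proof.
move=> S_herm lt_jW form_le.
have lt_jn : (j < n)%N := leq_trans lt_jW (rank_leq_col W).
have [H rankH form_ge] := high_eigenspace S_herm lt_jn.
have [v [v_neq0 vW vH]] : exists v : 'rV_n, [/\ v != 0, (v <= W)%MS & (v <= H)%MS].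
  by apply: exists_common_vector; rewrite rankH addnBA ?(ltnW lt_jn) // ltn_subRL ltn_add2r.
by rewrite -lecR -(ler_pM2r (_ : 0 < '[v])) ?dnorm_gt0 // (le_trans (form_ge v vH)) ?form_le.
Qed.

Lemma courant_fischer_lower (m n : nat) (S : 'M[C]_n) (W : 'M[C]_(m, n)) (j : nat) (a : R) :
  S \is hermsymmx -> (j < n)%N -> (n <= j + \rank W)%N ->
  (forall v : 'rV_n, (v <= W)%MS -> a%:C * '[v] <= '[v *m S, v]) ->
  a <= (eigenvals S)`_j.
Proof.
move=> S_herm lt_jn le_nW form_ge.
have [L rankL form_le] := low_eigenspace S_herm lt_jn.
have [v [v_neq0 vW vL]] : exists v : 'rV_n, [/\ v != 0, (v <= W)%MS & (v <= L)%MS].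
  by apply: exists_common_vector; rewrite rankL addnS ltnS addnC.
by rewrite -lecR -(ler_pM2r (_ : 0 < '[v])) ?dnorm_gt0 // (le_trans (form_ge v vW)) ?form_le.
Qed.

Lemma poincare_separation (m n : nat) (S : 'M[C]_n) (P : 'M[C]_(m, n)) (j : nat) :
  S \is hermsymmx -> P \is unitarymx -> (j < m)%N ->
  (eigenvals S)`_j <= (eigenvals (P *m S *m P ^t* ))`_j <= (eigenvals S)`_(n - m + j).
Proof.
move=> S_herm Pu lt_jm; have le_mn : (m <= n)%N.
  by rewrite -(mxrank_unitary Pu) rank_leq_col.
have form_comp (w : 'rV_m) : '[w *m P *m S, w *m P] = '[w *m (P *m S *m P ^t* ), w].
  by rewrite !mulmxA [RHS]dotmx_mull trmxCK.
have comp_herm : P *m S *m P ^t* \is hermsymmx.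
  move: S_herm; rewrite !hermsymmxE => /eqP eS.
  by rewrite !trmx_mul !map_mxM trmxCK -eS mulmxA.
have P_free : row_free P by rewrite /row_free mxrank_unitary.
have [L rankL form_le] := low_eigenspace comp_herm lt_jm.
have [H rankH form_ge] := high_eigenspace comp_herm lt_jm.
apply/andP; split.
  apply: (courant_fischer_upper (W := L *m P)) => //; first by rewrite mxrankMfree // rankL.
  move=> _ /submxP[c ->]; rewrite mulmxA form_comp dotmx_unitary // form_le //.
  exact: submxMl.
apply: (courant_fischer_lower (W := H *m P)) => //.
- by rewrite -ltn_subRL subKn.
- by rewrite mxrankMfree // rankH -addnA subnKC ?(ltnW lt_jm) // subnK.
- move=> _ /submxP[c ->]; rewrite mulmxA form_comp dotmx_unitary // form_ge //.
  exact: submxMl.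
Qed.

Lemma cauchy_interlacing (m n : nat) (S : 'M[C]_n) (h : 'I_m -> 'I_n) (j : nat) :
  S \is hermsymmx -> injective h -> (j < m)%N ->
  (eigenvals S)`_j <= (eigenvals (mxsub h h S))`_j <= (eigenvals S)`_(n - m + j).
Proof.
move=> S_herm h_inj lt_jm; pose P : 'M[C]_(m, n) := rowsub h 1%:M.
have trP : P ^t* = colsub h 1%:M.
  by apply/matrixP => i k; rewrite !mxE rmorph_nat eq_sym.
have -> : mxsub h h S = P *m S *m P ^t*.
  by rewrite trP mul_rowsub_mx mul1mx mulmx_colsub mulmx1; apply/matrixP => i k; rewrite !mxE.
apply: poincare_separation => //; apply/unitarymxP.
rewrite trP mul_rowsub_mx mul1mx; apply/matrixP => i k.
by rewrite !mxE (inj_eq h_inj).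
Qed.

End HermitianEigenvalues.

Section WeightedEigenvalues.
Variable R : rcfType.
Local Notation C := R[i].
Local Open Scope sesquilinear_scope.

Definition weight_mx (n : nat) (w : 'I_n -> R) : 'M[C]_n := diag_mx (\row_i (w i)%:C).

Definition weight_normalize (n : nat) (J : 'M[C]_n) (w : 'I_n -> R) : 'M[C]_n :=
  let G := weight_mx (fun i => (Num.sqrt (w i))^-1) in G *m J *m G.

Definition weighted_eigenvals (n : nat) (J : 'M[C]_n) (w : 'I_n -> R) : seq R :=
  eigenvals (weight_normalize J w).

Lemma size_weighted_eigenvals (n : nat) (J : 'M[C]_n) (w : 'I_n -> R) :
  size (weighted_eigenvals J w) = n.
Proof. exact: size_eigenvals. Qed.

Lemma weighted_eigenvals_sorted (n : nat) (J : 'M[C]_n) (w : 'I_n -> R) :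
  sorted <=%R (weighted_eigenvals J w).
Proof. exact: eigenvals_sorted. Qed.

Lemma weight_normalizeE (n : nat) (J : 'M[C]_n) (w : 'I_n -> R) (i j : 'I_n) :
  weight_normalize J w i j = ((Num.sqrt (w i))^-1 / Num.sqrt (w j))%:C * J i j.
Proof. by rewrite /weight_normalize /weight_mx mul_mx_diag mul_diag_mx !mxE rmorphM mulrAC. Qed.

Lemma weight_normalize_herm (n : nat) (J : 'M[C]_n) (w : 'I_n -> R) :
  J \is hermsymmx -> weight_normalize J w \is hermsymmx.
Proof.
move=> /hermsymmxP eJ; apply/hermsymmxP => i j.
rewrite !weight_normalizeE [RHS]rmorphM eJ [_ / _ in RHS]mulrC; congr (_ * _).
by rewrite [RHS]conjc_real.
Qed.

Section PositiveWeights.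
Variables (n : nat) (J : 'M[C]_n) (w : 'I_n -> R).
Hypothesis w_gt0 : forall i, 0 < w i.

Lemma weight_normalize_sub (z : C) :
  let G := weight_mx (fun i => (Num.sqrt (w i))^-1) in
  weight_normalize J w - z%:M = G *m (J - z *: weight_mx w) *m G.
Proof.
apply/matrixP => i j; rewrite mxE weight_normalizeE /weight_mx mul_mx_diag mul_diag_mx !mxE.
rewrite mulrBr mulrBl rmorphM mulrAC; congr (_ - _).
case: eqVneq => [->|_]; last by rewrite !mulr0n !mulr0 mul0r.
rewrite !mulr1n; set r := Num.sqrt (w j).
have -> : w j = r ^+ 2 by rewrite sqr_sqrtr ?ltW.
have r_neq0 : r%:C != 0 by rewrite fmorph_eq0 gt_eqF ?sqrtr_gt0.
by rewrite rmorphXn fmorphV /=; field.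
Qed.

Lemma count_weighted_eigenvals (z : C) : J \is hermsymmx ->
  count (fun x : R => x%:C == z) (weighted_eigenvals J w) =
  \rank (kermx (J - z *: weight_mx w)).
Proof.
move=> /(weight_normalize_herm w)/(count_eigenvals z) ->; rewrite weight_normalize_sub.
set G := weight_mx _; have G_unit : G \in unitmx.
  rewrite unitmxE det_diag unitfE; apply/prodf_neq0 => i _.
  by rewrite mxE fmorph_eq0 invr_eq0 gt_eqF ?sqrtr_gt0.
have G_full : row_full G by rewrite row_full_unit.
by rewrite !mxrank_ker mxrankMfree ?row_free_unit // (eqmxMfull _ G_full).
Qed.

Lemma det_weighted_eigenvals (x : R) : J \is hermsymmx ->
  \det (J - x%:C *: weight_mx w) =
  (\prod_i w i * \prod_(i < n) ((weighted_eigenvals J w)`_i - x))%:C.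
Proof.
move=> J_herm; have := det_eigenvals x%:C (weight_normalize_herm w J_herm).
rewrite weight_normalize_sub !det_mulmx mulrAC !det_diag -big_split rmorphM !rmorph_prod /=.
under [in RHS]eq_bigr => i _ do rewrite -rmorphB.
move=> <-; rewrite mulrA -big_split /= big1 ?mul1r // => i _.
rewrite !mxE -!rmorphM /= -expr2 exprVn sqr_sqrtr ?ltW // divff //.
by rewrite gt_eqF.
Qed.

End PositiveWeights.

Lemma weighted_interlacing (m n : nat) (J : 'M[C]_n) (w : 'I_n -> R) (h : 'I_m -> 'I_n)
    (j : nat) : J \is hermsymmx -> injective h -> (j < m)%N ->
  (weighted_eigenvals J w)`_j <= (weighted_eigenvals (mxsub h h J) (w \o h))`_j
    <= (weighted_eigenvals J w)`_(n - m + j).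
Proof.
move=> J_herm; rewrite /weighted_eigenvals.
have -> : weight_normalize (mxsub h h J) (w \o h) = mxsub h h (weight_normalize J w).
  by apply/matrixP => a b; rewrite [RHS]mxE !weight_normalizeE mxE.
exact/cauchy_interlacing/weight_normalize_herm.
Qed.

End WeightedEigenvalues.

Section JacobiMatrices.
Variable A : comNzRingType.
Implicit Types (d b : nat -> A).

(* The entries [b i.+1] couple the indices [i] and [i.+1]. *)
Definition jacobi (n : nat) d b : 'M[A]_n := \matrix_(i, j)
  (d i *+ (i == j :> nat) + b j *+ (j == i.+1 :> nat) + b i *+ (i == j.+1 :> nat)).

Definition periodic_jacobi (n : nat) d b (x y : A) : 'M[A]_n.+1 :=
  jacobi n.+1 d b + x *: delta_mx ord_max ord0 + y *: delta_mx ord0 ord_max.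

Lemma jacobi_sym (n : nat) d b (i j : 'I_n) : jacobi n d b i j = jacobi n d b j i.
Proof.
rewrite !mxE addrAC; congr (_ + _ + _).
by rewrite [j == i :> nat]eq_sym; case: eqP => // ->.
Qed.

Lemma jacobi_sub_diag (n : nat) d b (z : A) (e : nat -> A) :
  jacobi n d b - z *: diag_mx (\row_(i < n) e i) = jacobi n (fun i => d i - z * e i) b.
Proof.
apply/matrixP => i j; rewrite !mxE (val_eqE i j) mulrnBl -mulrnAr -[RHS]addrA [RHS]addrAC.
by rewrite addrA.
Qed.

Lemma jacobi_recurrence (n : nat) d b (y : nat -> A) (i : 'I_n) :
  d i * y i.+1 + b i.+1 * y i.+2 + b i * y i =
  (\row_j y j.+1 *m jacobi n d b) 0 i
  + (b 0 * y 0) *+ (i == 0 :> nat) + (b n * y n.+1) *+ (i.+1 == n).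
Proof.
have sum_at (F : nat -> A) (k : nat) :
    \sum_(j < n) F j *+ (j == k :> nat) = F k *+ (k < n)%N.
  by under eq_bigr do rewrite mulrb; rewrite -big_mkcond big_ord1_eq mulrb.
have -> : (\row_j y j.+1 *m jacobi n d b) 0 i =
    d i * y i.+1 + (b i.+1 * y i.+2) *+ (i.+1 < n)%N + (b i * y i) *+ (0 < i)%N.
  transitivity (\sum_(j < n) (d j * y j.+1) *+ (j == i :> nat)
      + \sum_(j < n) (b j * y j.+1) *+ (j == i.+1 :> nat)
      + \sum_(j < n) (b i * y j.+1) *+ (i == j.+1 :> nat)).
    rewrite mxE -!big_split; apply: eq_bigr => j _; rewrite !mxE /=.
    by rewrite !mulrDr !mulrnAr ![y _ * _]mulrC addrAC.
  rewrite (sum_at (fun j => d j * y j.+1)) (sum_at (fun j => b j * y j.+1)) ltn_ord.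
  congr (_ + _); have [->|i_gt0] := posnP i; first by rewrite big1.
  under eq_bigr do rewrite -(prednK i_gt0) eqSS [_ == nat_of_ord _]eq_sym.
  by rewrite (sum_at (fun j => _ * y j.+1)) prednK // ltnW.
rewrite lt0n ltn_neqAle ltn_ord andbT; case: eqP => [->|_]; case: eqP => [->|_] /=; ring.
Qed.

Lemma row_mul_delta (m p : nat) (u : 'rV[A]_m) (a : 'I_m) (c k : 'I_p) :
  (u *m delta_mx a c) 0 k = u 0 a *+ (k == c).
Proof.
rewrite mxE (bigD1 a) //= mxE eqxx big1 ?addr0 => [|l /negPf ne_l].
  by rewrite /= mulr_natr.
by rewrite mxE ne_l mulr0.
Qed.

Lemma periodic_jacobi_recurrence (n : nat) d b (x y : A) (u : nat -> A) (i : 'I_n.+1) :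
  d i * u i.+1 + b i.+1 * u i.+2 + b i * u i =
  (\row_j u j.+1 *m periodic_jacobi n d b x y) 0 i
  + (b 0 * u 0 - x * u n.+1) *+ (i == 0 :> nat)
  + (b n.+1 * u n.+2 - y * u 1) *+ (i == n :> nat).
Proof.
have -> : (\row_j u j.+1 *m periodic_jacobi n d b x y) 0 i =
    (\row_j u j.+1 *m jacobi n.+1 d b) 0 i
    + (x * u n.+1) *+ (i == 0 :> nat) + (y * u 1) *+ (i == n :> nat).
  rewrite 2!mulmxDr -!scalemxAr mxE [X in X + _]mxE [X in _ + X]mxE [X in _ + X + _]mxE.
  by rewrite !row_mul_delta !mxE -!val_eqE /= !mulrnAr.
by rewrite jacobi_recurrence eqSS !mulrnBl; ring.
Qed.

Lemma periodic_jacobi_sub_diag (n : nat) d b (x y z : A) (e : nat -> A) :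
  periodic_jacobi n d b x y - z *: diag_mx (\row_(i < n.+1) e i) =
  periodic_jacobi n (fun i => d i - z * e i) b x y.
Proof. by rewrite /periodic_jacobi -jacobi_sub_diag addrAC [_ + _ - _]addrAC. Qed.

Lemma eq_jacobi (n : nat) d d' b :
  (forall i : 'I_n, d i = d' i) -> jacobi n d b = jacobi n d' b.
Proof. by move=> eq_d; apply/matrixP => i j; rewrite !mxE eq_d. Qed.

Lemma periodic_jacobi_leading (n : nat) d b (x y : A) :
  let h := widen_ord (leqnSn n) in mxsub h h (periodic_jacobi n d b x y) = jacobi n d b.
Proof.
apply/matrixP => i j; rewrite !mxE -!val_eqE /=.
by rewrite (ltn_eqF (ltn_ord i)) (ltn_eqF (ltn_ord j)) andbF !mulr0 !addr0.
Qed.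

Lemma det_add_delta (n : nat) (B : 'M[A]_n) (i j : 'I_n) (x : A) :
  \det (B + x *: delta_mx i j) = \det B + x * cofactor B i j.
Proof.
rewrite !(expand_det_row _ i).
have cofE k : cofactor (B + x *: delta_mx i j) i k = cofactor B i k.
  rewrite /cofactor; congr (_ * \det _); apply/matrixP => a b.
  by rewrite !mxE eq_sym (negPf (neq_lift i a)) mulr0 addr0.
under eq_bigr do rewrite cofE !mxE eqxx /= mulrDl.
rewrite big_split /=; congr (_ + _); rewrite (bigD1 j) //= eqxx mulr1 big1 ?addr0 //.
by move=> k /negPf ->; rewrite mulr0 mul0r.
Qed.

Lemma cofactor_jacobi_corner (n : nat) d b :
  cofactor (jacobi n.+1 d b) ord_max ord0 = \prod_(i < n) - b i.+1.
Proof.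
rewrite /cofactor det_trig; last first.
  apply/is_trig_mxP => i j lt_ij; rewrite !mxE /= /bump leq0n add1n.
  rewrite [(n <= i)%N]leqNgt ltn_ord add0n eqSS.
  by rewrite (gtn_eqF lt_ij) !ltn_eqF ?addr0 // ltnW // ltnW.
rewrite addn0 prodrN card_ord; congr (_ * _); apply: eq_bigr => i _.
rewrite !mxE /= /bump leq0n add1n [(n <= i)%N]leqNgt ltn_ord add0n eqxx.
by rewrite ltn_eqF // ltn_eqF // add0r addr0.
Qed.

Lemma cofactor_jacobi_corner_tr (n : nat) d b :
  cofactor (jacobi n.+1 d b) ord0 ord_max = \prod_(i < n) - b i.+1.
Proof.
rewrite -(cofactor_jacobi_corner n d) -cofactor_tr; congr (cofactor _ _ _).
by apply/matrixP => i j; rewrite mxE jacobi_sym.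
Qed.

(* The determinant is affine in [x] and in [y]; only its [x * y] term involves the
   inner minor, and that term cancels in the difference. *)
Lemma det_periodic_jacobi_sub (n : nat) d b (x1 y1 x2 y2 : A) : x1 * y1 = x2 * y2 ->
  \det (periodic_jacobi n.+1 d b x1 y1) - \det (periodic_jacobi n.+1 d b x2 y2) =
  (x1 + y1 - (x2 + y2)) * \prod_(i < n.+1) - b i.+1.
Proof.
set T := jacobi n.+2 d b; pose inner := row' ord0 (col' ord_max T).
set p := \prod_(_ < _) _.
have cof x : cofactor (T + x *: delta_mx ord_max ord0) ord0 ord_max =
    p + x * ((-1) ^+ n.+1 * cofactor inner ord_max ord0).
  rewrite /p -(cofactor_jacobi_corner_tr _ d) {1 2}/cofactor /= add0n mulrCA -mulrDr.
  rewrite -det_add_delta; congr (_ * \det _); apply/matrixP => i j; rewrite !mxE.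
  congr (_ + _ * _%:R); rewrite -!val_eqE /= /bump leq0n add1n eqSS.
  by rewrite leqNgt ltn_ord add0n.
have detE x y : \det (periodic_jacobi n.+1 d b x y) = \det T + (x + y) * p
    + x * y * ((-1) ^+ n.+1 * cofactor inner ord_max ord0).
  by rewrite !det_add_delta cof cofactor_jacobi_corner -/p; ring.
by move=> xy; rewrite !detE xy; ring.
Qed.

End JacobiMatrices.

Section HermitianJacobi.
Variable R : rcfType.

Lemma jacobi_herm (n : nat) (d b : nat -> R) :
  jacobi n (fun i => (d i)%:C) (fun i => (b i)%:C) \is hermsymmx.
Proof.
apply/hermsymmxP => i j; rewrite jacobi_sym !mxE !rmorphD !rmorphMn /=.
by congr (_ *+ _ + _ *+ _ + _ *+ _); rewrite [RHS]conjc_real.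
Qed.

Lemma periodic_jacobi_herm (n : nat) (d b : nat -> R) (z : R[i]) :
  periodic_jacobi n (fun i => (d i)%:C) (fun i => (b i)%:C) (Num.conj z) z
    \is hermsymmx.
Proof.
apply/hermsymmxP => i j; have /hermsymmxP := jacobi_herm n.+1 d b => jacobi_conj.
rewrite /periodic_jacobi; move: (jacobi _ _ _) jacobi_conj => T T_conj.
rewrite !mxE !rmorphD !rmorphM !rmorph_nat /= conjCK -T_conj addrAC.
by rewrite ![(j == _) && _]andbC.
Qed.

End HermitianJacobi.

Section AlternatingRoots.
Variable R : realDomainType.

Lemma sign_between_roots (n j : nat) (s : seq R) (x : R) :
  sorted <=%R s -> size s = n -> (j < n)%N ->
  ((0 < j)%N -> s`_j.-1 <= x) -> x <= s`_j ->
  0 <= (-1) ^+ j * \prod_(i < n) (s`_i - x).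
Proof.
move=> s_sorted s_size lt_jn le_x ge_x.
have mono := sorted_leq_nth le_trans le_refl 0 s_sorted.
rewrite -(big_mkord xpredT (fun i => s`_i - x)) (big_cat_nat (leq0n j) (ltnW lt_jn)) /=.
rewrite mulrA mulr_ge0 //; last first.
  rewrite big_nat_cond; apply: prodr_ge0 => i /andP[/andP[le_ji lt_in] _].
  by rewrite subr_ge0 (le_trans ge_x) // mono // inE s_size.
rewrite big_mkord; under eq_bigr do rewrite -opprB.
rewrite prodrN card_ord mulrA -expr2 sqrr_sign mul1r; apply: prodr_ge0 => i _.
have lt_ij := ltn_ord i; have j_gt0 : (0 < j)%N := leq_ltn_trans (leq0n i) lt_ij.
rewrite subr_ge0 (le_trans _ (le_x j_gt0)) // mono ?inE ?s_size //.
- exact: ltn_trans lt_ij lt_jn.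
- exact: leq_ltn_trans (leq_pred _) lt_jn.
- by rewrite -ltnS prednK.
Qed.

Lemma alternating_roots (n : nat) (s t : seq R) (d : R) :
  sorted <=%R s -> size s = n -> sorted <=%R t -> size t = n -> 0 < d ->
  (forall x, \prod_(i < n) (s`_i - x) = \prod_(i < n) (t`_i - x) + d) ->
  (forall j, (j.+1 < n)%N -> s`_j <= t`_j.+1) ->
  (forall j, (j.+1 < n)%N -> t`_j <= s`_j.+1) ->
  forall j, (j < n)%N -> if ~~ odd j then t`_j < s`_j else s`_j < t`_j.
Proof.
move=> s_sorted s_size t_sorted t_size d_gt0 st_prod le_st le_ts j lt_jn.
have prod0 (u : seq R) : \prod_(i < n) (u`_i - u`_j) = 0.
  by rewrite (bigD1 (Ordinal lt_jn)) //= subrr mul0r.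
have prev (u v : seq R) : (forall k, (k.+1 < n)%N -> u`_k <= v`_k.+1) ->
    (0 < j)%N -> u`_j.-1 <= v`_j.
  by case: j lt_jn {prod0} => // j lt_jn le_uv _; exact: le_uv.
case: ifPn => [j_even|]; [|rewrite negbK => j_odd]; rewrite ltNge; apply/negP => le_j.
  have := sign_between_roots t_sorted t_size lt_jn (prev _ _ le_ts) le_j.
  have := st_prod s`_j; rewrite prod0 => /esym/eqP; rewrite addr_eq0 => /eqP ->.
  by rewrite -signr_odd (negPf j_even) expr0 mul1r oppr_ge0 leNgt d_gt0.
have := sign_between_roots s_sorted s_size lt_jn (prev _ _ le_st) le_j.
by rewrite st_prod prod0 add0r -signr_odd j_odd expr1 mulN1r oppr_ge0 leNgt d_gt0.
Qed.

End AlternatingRoots.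

(* The constraints [G] leave at least [n] degrees of freedom, so once [L] is injective on
   their solutions it is a bijection onto row vectors of size [n]. *)
Lemma rank_kermx_elim (F : fieldType) (k n p : nat) (B : 'M[F]_(k + n, p))
    (G : 'M[F]_(k + n, k)) (L : 'M[F]_(k + n, n)) (T : 'M[F]_n) :
  (forall y : 'rV_(k + n), y *m B = 0 <-> y *m G = 0 /\ y *m L *m T = 0) ->
  (forall y : 'rV_(k + n), y *m G = 0 -> y *m L = 0 -> y = 0) ->
  \rank (kermx B) = \rank (kermx T).
Proof.
move=> kerB inj_GL; pose Q := row_mx G L.
have Q_unit : Q \in unitmx.
  rewrite -row_free_unit -kermx_eq0; apply/rowV0P => y /sub_kermxP.
  by rewrite mul_mx_row => /eqP; rewrite row_mx_eq0 => /andP[/eqP yG /eqP]; exact: inj_GL.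
have -> : \rank (kermx B) = \rank (kermx (Q *m block_mx 1%:M 0 0 T)).
  apply/eqmx_rank/andP; split; apply/rV_subP => y /sub_kermxP yker; apply/sub_kermxP.
    have [yG yLT] := (kerB y).1 yker.
    by rewrite mulmxA mul_mx_row mul_row_block yG yLT !mulmx0 mul0mx !addr0 row_mx0.
  apply/kerB; move: yker; rewrite mulmxA mul_mx_row mul_row_block.
  rewrite !mulmx0 add0r addr0 mulmx1 => /eqP; rewrite row_mx_eq0 => /andP[/eqP yG /eqP].
  by split.
rewrite !mxrank_ker (eqmxMfull _ (_ : row_full Q)) ?row_full_unit //.
by rewrite rank_diag_block_mx mxrank1 subnDl.
Qed.

Lemma mulmx_col2 (A : pzSemiRingType) (m : nat) (B : 'M[A]_(m, 2)) (v : 'cV_2) (k : 'I_m) :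
  (B *m v) k 0 = B k 0 * v 0 0 + B k 1 * v 1 0.
Proof.
by rewrite mxE big_ord_recl big_ord1 (_ : lift ord0 ord0 = 1) //; exact: val_inj.
Qed.

Lemma col2_eq0 (V : nmodType) (v : 'cV[V]_2) : v = 0 <-> v 0 0 = 0 /\ v 1 0 = 0.
Proof.
split=> [->|[v0 v1]]; first by rewrite !mxE.
apply/colP => k; rewrite [RHS]mxE.
by case: k => -[|[|//]] lt_k; [rewrite -[RHS]v0|rewrite -[RHS]v1]; congr (v _ _); apply: val_inj.
Qed.

Lemma det_mx2 (A : comNzRingType) (B : 'M[A]_2) :
  \det B = B 0 0 * B 1 1 - B 0 1 * B 1 0.
Proof.
rewrite (expand_det_row _ 0) big_ord_recl big_ord1 /cofactor !det_mx11 !mxE /=.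
have -> : lift ord0 ord0 = 1 :> 'I_2 by apply: val_inj.
have -> : lift 1 0 = 0 :> 'I_2 by apply: val_inj.
by rewrite expr0 expr1; ring.
Qed.

Section SturmLiouville.
Variables (R : realType) (f q w : nat -> R).
Local Notation C := R[i].

Section Multiplicity.
Variables (N : nat) (A B : 'M[C]_2) (lam : C).
Local Notation residual := (@resid R N f q w A B lam).

Lemma resid_is_linear : linear residual.
Proof.
have yat_linear k a (u v : 'rV[C]_N.+2) : yat (a *: u + v) k = a * yat u k + yat v k.
  by rewrite /yat !mxE.
move=> a u v; apply/rowP => j; rewrite !mxE; case: ifP => _.
  by rewrite /sl_resid /Dy !yat_linear; ring.
rewrite !big_ord_recl !big_ord0 !mxE /= /Dy !yat_linear; ring.
Qed.

HB.instance Definition _ := GRing.isLinear.Build C 'rV[C]_N.+2 'rV[C]_N.+2 _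
  residual resid_is_linear.

Lemma resid_eqn (y : 'rV[C]_N.+2) (i : nat) : (i < N)%N ->
  residual y 0 (inord i) = sl_resid f q w lam y i.+1.
Proof. by move=> lt_iN; rewrite mxE inordK ?lt_iN // ltnW // ltnW. Qed.

Lemma resid_bc (y : 'rV[C]_N.+2) (k : 'I_2) :
  residual y 0 (inord (N + k)) = bc_resid f A B y k 0.
Proof.
rewrite mxE inordK; last by rewrite -(addn2 N) ltn_add2l.
by rewrite ltnNge leq_addr /= addKn inord_val.
Qed.

Definition tail_eqns (n : nat) (y : 'rV[C]_N.+2) : Prop :=
  (forall i, (n <= i < N)%N -> sl_resid f q w lam y i.+1 = 0) /\ bc_resid f A B y = 0.

Lemma tail_eqnsP (n : nat) (y : 'rV[C]_N.+2) : (n <= N)%N ->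
  tail_eqns n y <-> forall i, (n <= i < N.+2)%N -> residual y 0 (inord i) = 0.
Proof.
move=> le_nN; split=> [[eqs bc] i /andP[le_ni lt_i]|y0].
  have [lt_iN|le_Ni] := ltnP i N; first by rewrite resid_eqn ?eqs ?le_ni.
  have lt_i2 : (i - N < 2)%N by rewrite ltn_subLR // addn2.
  by rewrite -(subnKC le_Ni) (resid_bc y (Ordinal lt_i2)) bc mxE.
split=> [i /andP[le_ni lt_iN]|].
  by rewrite -resid_eqn // y0 // le_ni ltnW // ltnW.
apply/colP => k; rewrite -resid_bc [RHS]mxE y0 // -(addn2 N) ltn_add2l ltn_ord andbT.
exact: leq_trans le_nN (leq_addr _ _).
Qed.

Lemma resid_eq0P (y : 'rV[C]_N.+2) : residual y = 0 <-> tail_eqns 0 y.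
Proof.
split=> [y0|/(tail_eqnsP y (leq0n N)) y0]; first by apply/tail_eqnsP => // i _; rewrite y0 mxE.
by apply/rowP => j; rewrite [RHS]mxE -[j]inord_val y0 /=.
Qed.

End Multiplicity.

(* The tail equations express [y_0] and [y_(n+1) ... y_(k+n+1)] through [y_1 ... y_n]. *)
Lemma mult_elim (k n N : nat) (A B : 'M[C]_2) (lam : C) (T : 'M[C]_n) : (k + n)%N = N ->
  (forall y : 'rV[C]_N.+2, tail_eqns A B lam n y -> forall i : 'I_n,
    sl_resid f q w lam y i.+1 = (\row_(j < n) yat y j.+1 *m T) 0 i) ->
  (forall y : 'rV[C]_N.+2, tail_eqns A B lam n y ->
    (forall i, (i < n)%N -> yat y i.+1 = 0) -> y = 0) ->
  mult N f q w A B lam = \rank (kermx T).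
Proof.
case: N / => eqs inj; pose D := lin1_mx (@resid R (k + n) f q w A B lam).
pose G : 'M[C]_(2 + k + n, 2 + k) := colsub (fun j => inord (n + j)) D.
pose L : 'M[C]_(2 + k + n, n) := colsub (fun j => inord j.+1) 1%:M.
have yD y : y *m D = resid f q w A B lam y by rewrite mul_rV_lin1.
have yL y : y *m L = \row_(j < n) yat y j.+1.
  by rewrite mulmx_colsub mulmx1; apply/rowP => j; rewrite !mxE.
have le_n : (n <= k + n)%N := leq_addl k n.
have yG y : y *m G = 0 <-> tail_eqns A B lam n y.
  apply: iff_trans (iff_sym (tail_eqnsP _ _ _ _ le_n)); rewrite mulmx_colsub yD.
  split=> [/rowP y0 i /andP[le_ni lt_i]|y0].
    have lt_in : (i - n < 2 + k)%N by rewrite ltn_subLR // addnC.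
    by have := y0 (Ordinal lt_in); rewrite mxE /= subnKC // => ->; rewrite mxE.
  apply/rowP => j; rewrite mxE [RHS]mxE y0 // leq_addr -[(k + n).+2]/(2 + k + n)%N.
  by rewrite (addnC n) ltn_add2r ltn_ord.
apply: (rank_kermx_elim (G := G) (L := L)) => y; rewrite yL.
  rewrite yG yD; split=> [/resid_eq0P[all_eqs bc]|[tail yT]].
    have tail : tail_eqns A B lam n y by split=> // i /andP[_ /all_eqs].
    by split=> //; apply/rowP => i; rewrite -eqs // all_eqs ?mxE // ltn_addl.
  apply/resid_eq0P; split=> [i lt_iN|]; last exact: tail.2.
  have [lt_in|le_ni] := ltnP i n; last by rewrite tail.1 // le_ni.
  by rewrite (eqs y tail (Ordinal lt_in)) yT mxE.
move=> /yG tail /rowP y0; apply: inj => // i lt_in.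
by have := y0 (Ordinal lt_in); rewrite !mxE.
Qed.

Definition sl_diag (i : nat) : R := q i.+1 + f i + f i.+1.

Lemma sl_residE (N : nat) (lam : C) (y : 'rV[C]_N.+2) (i : nat) :
  sl_resid f q w lam y i.+1 =
  ((sl_diag i)%:C - lam * (w i.+1)%:C) * yat y i.+1
  + (- f i.+1)%:C * yat y i.+2 + (- f i)%:C * yat y i.
Proof. by rewrite /sl_diag /sl_resid /Dy !rmorphD !rmorphN /=; ring. Qed.

Lemma coupled_bcP (N : nat) (M : 'M[R]_2) (z : C) (y : 'rV[C]_N.+2) :
  bc_resid f (z *: cmx M) (- 1%:M) y = 0 <->
  z * ((M 0 0)%:C * yat y 0 + (M 0 1)%:C * ((f 0)%:C * Dy y 0)) = yat y N /\
  z * ((M 1 0)%:C * yat y 0 + (M 1 1)%:C * ((f 0)%:C * Dy y 0)) = (f N)%:C * Dy y N.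
Proof.
have bcE k : bc_resid f (z *: cmx M) (- 1%:M) y k 0 = z * ((M k 0)%:C * yat y 0
    + (M k 1)%:C * ((f 0)%:C * Dy y 0)) - bvec f y N k 0.
  rewrite /bc_resid mulNmx mul1mx -scalemxAl mxE [X in X + _]mxE [X in _ + X]mxE.
  by rewrite mulmx_col2 !mxE.
rewrite col2_eq0 !bcE !mxE /=; split=> -[]; last by move=> -> ->; rewrite !subrr.
by move=> /subr0_eq -> /subr0_eq ->.
Qed.

Lemma separated_bcP (N : nat) (K : 'M[R]_2) (y : 'rV[C]_N.+2) :
  bc_resid f (UK_A K) (UK_B R) y = 0 <->
  (K 0 0)%:C * yat y 0 + (K 0 1)%:C * ((f 0)%:C * Dy y 0) = 0 /\ yat y N = 0.
Proof.
rewrite col2_eq0 ![bc_resid _ _ _ _ _ _]mxE !mulmx_col2 !mxE /=.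
by rewrite !mul0r !mul1r !addr0 add0r.
Qed.

Definition pivot (M : 'M[R]_2) : R := M 0 0 - f 0 * M 0 1.

(* [f_0 y_0 = coupling * conj z * y_N - left_shift * y_1] and
   [f_N y_(N+1) = coupling * z * y_1 - right_shift * y_N] under the coupled condition. *)
Definition coupling (M : 'M[R]_2) : R := f 0 / pivot M.

Definition left_shift (M : 'M[R]_2) : R := coupling M * (f 0 * M 0 1).

Definition right_shift (N : nat) (M : 'M[R]_2) : R :=
  - ((M 1 0 - f 0 * M 1 1) / pivot M) - f N.

Definition separated_diag (M : 'M[R]_2) (i : nat) : R :=
  sl_diag i + left_shift M *+ (i == 0).

Definition coupled_diag (n : nat) (M : 'M[R]_2) (i : nat) : R :=
  separated_diag M i + right_shift n.+1 M *+ (i == n).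

Definition separated_mx (n : nat) (M : 'M[R]_2) : 'M[C]_n :=
  jacobi n (fun i => (separated_diag M i)%:C) (fun i => (- f i)%:C).

Definition coupled_mx (n : nat) (M : 'M[R]_2) (z : C) : 'M[C]_n.+1 :=
  let c := - (coupling M)%:C in
  periodic_jacobi n (fun i => (coupled_diag n M i)%:C) (fun i => (- f i)%:C)
    (c * Num.conj z) (c * z).

Definition sl_weight (n : nat) (i : 'I_n) : R := w i.+1.

Lemma separated_pencilE (n : nat) (M : 'M[R]_2) (lam : C) :
  separated_mx n M - lam *: weight_mx (@sl_weight n) =
  jacobi n (fun i => (separated_diag M i)%:C - lam * (w i.+1)%:C) (fun i => (- f i)%:C).
Proof. exact: (jacobi_sub_diag _ _ _ _ (fun i => (w i.+1)%:C)). Qed.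

Lemma coupled_pencilE (n : nat) (M : 'M[R]_2) (z lam : C) :
  let c := - (coupling M)%:C in
  coupled_mx n M z - lam *: weight_mx (@sl_weight n.+1) =
  periodic_jacobi n (fun i => (coupled_diag n M i)%:C - lam * (w i.+1)%:C)
    (fun i => (- f i)%:C) (c * Num.conj z) (c * z).
Proof. exact: (periodic_jacobi_sub_diag _ _ _ _ _ _ (fun i => (w i.+1)%:C)). Qed.

Lemma yat_eq0 (N : nat) (y : 'rV[C]_N.+2) :
  (forall i, (i < N.+2)%N -> yat y i = 0) -> y = 0.
Proof.
by move=> y0; apply/rowP => i; rewrite mxE -[RHS](y0 i (ltn_ord i)) /yat inord_val.
Qed.

Section Elimination.
Variables (N : nat) (M : 'M[R]_2).
Hypothesis pivot_neq0 : pivot M != 0.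
Implicit Type y : 'rV[C]_N.+2.

Lemma pivot_mul_y0 y :
  (pivot M)%:C * yat y 0 = (M 0 0)%:C * yat y 0 + (M 0 1)%:C * ((f 0)%:C * Dy y 0)
    - (f 0)%:C * (M 0 1)%:C * yat y 1.
Proof. by rewrite /pivot /Dy rmorphB rmorphM /=; ring. Qed.

Lemma separated_first y : bc_resid f (UK_A M) (UK_B R) y = 0 ->
  (f 0)%:C * yat y 0 = - (left_shift M)%:C * yat y 1.
Proof.
have pivotC_neq0 : (pivot M)%:C != 0 by rewrite fmorph_eq0.
move=> /separated_bcP[bc0 _]; apply: (mulfI pivotC_neq0).
rewrite mulrCA pivot_mul_y0 bc0 /left_shift /coupling !rmorphM fmorphV /=.
by move: (pivot M)%:C pivotC_neq0 => p p_neq0; field.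
Qed.

Section Coupled.
Variable z : C.
Hypothesis z_norm1 : `|z| = 1.

Lemma coupled_first y : bc_resid f (z *: cmx M) (- 1%:M) y = 0 ->
  (f 0)%:C * yat y 0 =
  (coupling M)%:C * Num.conj z * yat y N - (left_shift M)%:C * yat y 1.
Proof.
have pivotC_neq0 : (pivot M)%:C != 0 by rewrite fmorph_eq0.
move=> /coupled_bcP[<- _]; apply: (mulfI pivotC_neq0).
rewrite mulrCA pivot_mul_y0 /left_shift /coupling !rmorphM fmorphV /=.
have -> x : (f 0)%:C / (pivot M)%:C * Num.conj z * (z * x) =
    (f 0)%:C / (pivot M)%:C * (z * Num.conj z) * x by ring.
rewrite -normCK z_norm1 expr1n.
by move: (pivot M)%:C pivotC_neq0 => p p_neq0; field.
Qed.

Lemma coupled_last y : \det M = 1 -> bc_resid f (z *: cmx M) (- 1%:M) y = 0 ->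
  (f N)%:C * yat y N.+1 =
  (coupling M)%:C * z * yat y 1 - (right_shift N M)%:C * yat y N.
Proof.
have pivotC_neq0 : (pivot M)%:C != 0 by rewrite fmorph_eq0.
move=> detM /coupled_bcP[bc0 bc1].
have pivot_mul_last : (pivot M)%:C * ((f N)%:C * Dy y N) =
    ((M 1 0)%:C - (f 0)%:C * (M 1 1)%:C) * yat y N + (f 0)%:C * z * yat y 1.
  have detMC : (M 0 0)%:C * (M 1 1)%:C - (M 0 1)%:C * (M 1 0)%:C = 1.
    by rewrite -!rmorphM -rmorphB -det_mx2 detM.
  rewrite -bc0 -bc1 -[(f 0)%:C * z]mulr1 -detMC /pivot /Dy rmorphB rmorphM /=; ring.
have -> : (f N)%:C * yat y N.+1 = (f N)%:C * Dy y N + (f N)%:C * yat y N.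
  by rewrite /Dy; ring.
apply: (mulfI pivotC_neq0); rewrite mulrDr pivot_mul_last /right_shift /coupling.
move: (pivot M) pivotC_neq0 => p p_neq0.
by rewrite !(rmorphB, rmorphN, rmorphM, fmorphV) /=; field.
Qed.

End Coupled.
End Elimination.

Section MultiplicityOfMatrices.
Variables (n : nat) (M : 'M[R]_2).
Local Notation N := n.+1.
Hypothesis f_neq0 : forall i, (i <= N)%N -> f i != 0.
Hypothesis pivot_neq0 : pivot M != 0.

Lemma f_mul_eq0 (i : nat) (x : C) : (i <= N)%N -> (f i)%:C * x = 0 -> x = 0.
Proof.
by move=> le_iN /eqP; rewrite mulf_eq0 fmorph_eq0 (negPf (f_neq0 le_iN)) => /eqP.
Qed.

Lemma mult_coupled (z lam : C) : `|z| = 1 -> \det M = 1 ->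
  mult N f q w (z *: cmx M) (- 1%:M) lam =
  \rank (kermx (coupled_mx n M z - lam *: weight_mx (@sl_weight N))).
Proof.
move=> z_norm1 detM; apply: (mult_elim (add0n N)) => y [_ bc].
  move=> i; rewrite coupled_pencilE sl_residE.
  have /eqP := periodic_jacobi_recurrence (fun i => (coupled_diag n M i)%:C - lam * (w i.+1)%:C)
    (fun i => (- f i)%:C) (- (coupling M)%:C * Num.conj z) (- (coupling M)%:C * z) (yat y) i.
  rewrite -!subr_eq => /eqP <-.
  rewrite !rmorphN !mulNr (coupled_first pivot_neq0 z_norm1 bc).
  rewrite (coupled_last pivot_neq0 detM bc) /coupled_diag /separated_diag.
  move: (sl_diag i) (left_shift M) (right_shift N M) => d l r.
  rewrite !rmorphD !rmorphMn /=.
  have y_first : i = 0 :> nat -> yat y 1 = yat y i.+1 by move=> ->.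
  have y_last : i = n :> nat -> yat y N = yat y i.+1 by move=> ->.
  by case: eqP => [/y_first ->|_]; case: eqP => [/y_last ->|_];
    rewrite ?mulr1n ?mulr0n; ring.
move=> y_mid; have y0 : yat y 0 = 0.
  apply: (f_mul_eq0 (leq0n N)); rewrite (coupled_first pivot_neq0 z_norm1 bc).
  by rewrite !y_mid // !mulr0 subr0.
apply: yat_eq0 => -[|i] //; rewrite !ltnS leq_eqVlt => /predU1P[->|/y_mid //].
apply: (f_mul_eq0 (leqnn N)); rewrite (coupled_last pivot_neq0 detM bc).
by rewrite !y_mid // !mulr0 subr0.
Qed.

Lemma mult_separated (lam : C) :
  mult N f q w (UK_A M) (UK_B R) lam =
  \rank (kermx (separated_mx n M - lam *: weight_mx (@sl_weight n))).
Proof.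
apply: (mult_elim (add1n n)) => y [tail bc]; have /separated_bcP[_ yN0] := bc.
  move=> i; rewrite separated_pencilE sl_residE.
  have /eqP := jacobi_recurrence (fun i => (separated_diag M i)%:C - lam * (w i.+1)%:C)
    (fun i => (- f i)%:C) (yat y) i.
  rewrite -!subr_eq => /eqP <-.
  rewrite [X in X *+ (_ == n)](_ : _ = 0); last by rewrite yN0 mulr0.
  rewrite mul0rn subr0 !rmorphN !mulNr (separated_first pivot_neq0 bc) /separated_diag.
  move: (sl_diag i) (left_shift M) => d l; rewrite !rmorphD !rmorphMn /=.
  by case: eqP => [->|_]; rewrite ?mulr1n ?mulr0n; ring.
move=> y_mid; have y0 : yat y 0 = 0.
  apply: (f_mul_eq0 (leq0n N)); rewrite (separated_first pivot_neq0 bc).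
  have [n0|n_gt0] := posnP n; last by rewrite y_mid ?mulr0.
  have -> : yat y 1 = yat y N by congr (yat y _); rewrite n0.
  by rewrite yN0 mulr0.
have y_le i : (i <= N)%N -> yat y i = 0.
  case: i => // i; rewrite ltnS leq_eqVlt => /predU1P[->|/y_mid //].
  exact: yN0.
apply: yat_eq0 => i; rewrite ltnS leq_eqVlt => /predU1P[->|/y_le //].
apply: (f_mul_eq0 (leqnn N)); have := tail n.
rewrite leqnn ltnSn sl_residE (y_le N) // (y_le n) //.
by rewrite !mulr0 add0r addr0 rmorphN mulNr => /(_ isT)/eqP; rewrite oppr_eq0 => /eqP.
Qed.

End MultiplicityOfMatrices.

Definition coupled_eigenvals (n : nat) (M : 'M[R]_2) (z : C) : seq R :=
  weighted_eigenvals (coupled_mx n M z) (@sl_weight n.+1).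

Definition separated_eigenvals (n : nat) (M : 'M[R]_2) : seq R :=
  weighted_eigenvals (separated_mx n M) (@sl_weight n).

Lemma size_coupled_eigenvals (n : nat) (M : 'M[R]_2) (z : C) :
  size (coupled_eigenvals n M z) = n.+1.
Proof. exact: size_weighted_eigenvals. Qed.

Lemma size_separated_eigenvals (n : nat) (M : 'M[R]_2) :
  size (separated_eigenvals n M) = n.
Proof. exact: size_weighted_eigenvals. Qed.

Lemma separated_eigenvals_opp (n : nat) (M : 'M[R]_2) :
  separated_eigenvals n (- M) = separated_eigenvals n M.
Proof.
have left_opp : left_shift (- M) = left_shift M.
  rewrite /left_shift /coupling /pivot !mxE.
  have -> : - M 0 0 - f 0 * - M 0 1 = - (M 0 0 - f 0 * M 0 1) by ring.
  by rewrite invrN; ring.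
rewrite /separated_eigenvals (_ : separated_mx n (- M) = separated_mx n M) //.
by apply: eq_jacobi => i; rewrite /separated_diag left_opp.
Qed.

Lemma separated_eigenvals_sign (n : nat) (K M : 'M[R]_2) : M = K \/ M = - K ->
  separated_eigenvals n K = separated_eigenvals n M.
Proof. by case=> ->; rewrite ?separated_eigenvals_opp. Qed.

Lemma coupled_mx_herm (n : nat) (M : 'M[R]_2) (z : C) : coupled_mx n M z \is hermsymmx.
Proof.
rewrite /coupled_mx; set c := - _.
have -> : c * Num.conj z = Num.conj (c * z).
  by rewrite rmorphM rmorphN; congr (- _ * _); rewrite [RHS]conjc_real.
exact: periodic_jacobi_herm.
Qed.

Lemma separated_mx_herm (n : nat) (M : 'M[R]_2) : separated_mx n M \is hermsymmx.
Proof. exact: jacobi_herm. Qed.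

Lemma coupled_mx_leading (n : nat) (M : 'M[R]_2) (z : C) :
  let h := widen_ord (leqnSn n) in mxsub h h (coupled_mx n M z) = separated_mx n M.
Proof.
rewrite /= periodic_jacobi_leading; apply: eq_jacobi => i.
by rewrite /coupled_diag ltn_eqF // addr0.
Qed.

Lemma coupled_separated_interlacing (n : nat) (M : 'M[R]_2) (z : C) (j : nat) :
  (j < n)%N ->
  (coupled_eigenvals n M z)`_j <= (separated_eigenvals n M)`_j
    <= (coupled_eigenvals n M z)`_j.+1.
Proof.
rewrite /separated_eigenvals -(coupled_mx_leading n M z) => lt_jn.
have widen_inj : injective (widen_ord (leqnSn n)).
  by move=> i k /(congr1 val) eq_ik; apply: val_inj.
have := weighted_interlacing (@sl_weight n.+1) (coupled_mx_herm n M z) widen_inj lt_jn.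
by rewrite subSnn.
Qed.

Lemma coupled_eigenvals_overlap (n : nat) (M : 'M[R]_2) (z1 z2 : C) (j : nat) :
  (j < n)%N -> (coupled_eigenvals n M z1)`_j <= (coupled_eigenvals n M z2)`_j.+1.
Proof.
move=> lt_jn; have /andP[le1 _] := coupled_separated_interlacing M z1 lt_jn.
by have /andP[_ le2] := coupled_separated_interlacing M z2 lt_jn; apply: le_trans le1 le2.
Qed.

Lemma det_coupled_sub (n : nat) (M : 'M[R]_2) (z1 z2 : C) (x : R) :
  `|z1| = 1 -> `|z2| = 1 ->
  \det (coupled_mx n.+1 M z1 - x%:C *: weight_mx (@sl_weight n.+2)) -
  \det (coupled_mx n.+1 M z2 - x%:C *: weight_mx (@sl_weight n.+2)) =
  (2 * (complex.Re z2 - complex.Re z1) * coupling M * \prod_(i < n.+1) f i.+1)%:C.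
Proof.
move=> z1_norm1 z2_norm1; rewrite !coupled_pencilE.
set c := - (coupling M)%:C.
have corner_prod z : `|z| = 1 -> c * Num.conj z * (c * z) = c ^+ 2.
  by move=> z_norm1; rewrite mulrACA [Num.conj z * z]mulrC -normCK z_norm1 expr1n mulr1.
have corner_sum z : c * Num.conj z + c * z = c * (2 * complex.Re z)%:C.
  by rewrite -mulrDr addrC addcJ rmorphM rmorph_nat.
rewrite det_periodic_jacobi_sub ?corner_prod // !corner_sum -mulrBr -rmorphB.
under eq_bigr do rewrite rmorphN opprK.
rewrite -rmorph_prod /c -rmorphN -!rmorphM; congr (_)%:C; ring.
Qed.

Section PositiveWeights.
Variables (n : nat) (M : 'M[R]_2).
Local Notation N := n.+2.
Hypothesis f_neq0 : forall i, (i <= N)%N -> f i != 0.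
Hypothesis w_gt0 : forall i, (1 <= i <= N)%N -> 0 < w i.

Lemma sl_weight_gt0 (m : nat) (i : 'I_m) : (m <= N)%N -> 0 < sl_weight i.
Proof. by move=> le_mN; apply: w_gt0; apply: leq_trans (ltn_ord i) le_mN. Qed.

Lemma ev_list_coupled (z : C) : `|z| = 1 -> \det M = 1 -> pivot M != 0 ->
  ev_list N f q w (z *: cmx M) (- 1%:M) (coupled_eigenvals n.+1 M z).
Proof.
move=> z_norm1 detM pivot_neq0; split; first exact: weighted_eigenvals_sorted.
move=> lam; rewrite mult_coupled // count_weighted_eigenvals ?coupled_mx_herm // => i.
exact: sl_weight_gt0.
Qed.

Lemma ev_list_separated : pivot M != 0 ->
  ev_list N f q w (UK_A M) (UK_B R) (separated_eigenvals n.+1 M).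
Proof.
move=> pivot_neq0; split; first exact: weighted_eigenvals_sorted.
move=> lam; rewrite mult_separated // count_weighted_eigenvals ?separated_mx_herm // => i.
exact: sl_weight_gt0.
Qed.

Lemma coupling_prod_gt0 : 0 < \prod_(i < N) (f i)^-1 -> 0 < pivot M ->
  0 < coupling M * \prod_(i < n.+1) f i.+1.
Proof.
rewrite prodfV invr_gt0 [X in 0 < X -> _]big_ord_recl => prod_gt0 pivot_gt0.
by rewrite /coupling mulrAC divr_gt0.
Qed.

Lemma coupled_eigenvals_alternate (z1 z2 : C) (j : nat) :
  0 < \prod_(i < N) (f i)^-1 -> 0 < pivot M ->
  `|z1| = 1 -> `|z2| = 1 -> complex.Re z1 < complex.Re z2 ->
  (j < N)%N ->
  if ~~ odd j then (coupled_eigenvals n.+1 M z2)`_j < (coupled_eigenvals n.+1 M z1)`_j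
  else (coupled_eigenvals n.+1 M z1)`_j < (coupled_eigenvals n.+1 M z2)`_j.
Proof.
move=> prod_gt0 pivot_gt0 z1_norm1 z2_norm1 lt_Re.
have weights_gt0 (i : 'I_N) : 0 < sl_weight i by exact: sl_weight_gt0.
have prod_w_gt0 : 0 < \prod_(i < N) sl_weight i by apply: prodr_gt0 => i _.
pose d := 2 * (complex.Re z2 - complex.Re z1) * coupling M * \prod_(i < n.+1) f i.+1.
have d_gt0 : 0 < d.
  by rewrite /d -mulrA mulr_gt0 ?coupling_prod_gt0 // mulr_gt0 ?subr_gt0.
apply: (alternating_roots (d := d / \prod_(i < N) sl_weight i)).
- exact: weighted_eigenvals_sorted.
- exact: size_coupled_eigenvals.
- exact: weighted_eigenvals_sorted.
- exact: size_coupled_eigenvals.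
- by rewrite divr_gt0.
- move=> x; have := det_coupled_sub n M x z1_norm1 z2_norm1.
  rewrite !det_weighted_eigenvals ?coupled_mx_herm // -rmorphB -mulrBr => /complexI.
  by rewrite -/d => <-; rewrite mulrAC divff ?gt_eqF // mul1r addrC subrK.
- by move=> k lt_k; apply: coupled_eigenvals_overlap.
- by move=> k lt_k; apply: coupled_eigenvals_overlap.
Qed.

End PositiveWeights.

End SturmLiouville.

Lemma norm_expi (R : realType) (g : R) : `|expi g| = 1.
Proof.
have -> : expi g = cos g +i* sin g by rewrite /expi; simpc.
by rewrite normc_def cos2Dsin2 sqrtr1.
Qed.

Lemma Re_expi_bounds (R : realType) (g : R) :
  (- pi < g < 0) || (0 < g < pi) -> -1 < complex.Re (expi g) < 1.
Proof.
have -> : complex.Re (expi g) = cos g by rewrite /expi; simpc.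
suff cos_bounds (x : R) : 0 < x < pi -> -1 < cos x < 1.
  by case/orP => g_range; [rewrite -cosN cos_bounds // oppr_gt0 ltrNl andbC|exact: cos_bounds].
move=> /andP[x_gt0 x_lt].
have x_itv : x \in `[0, pi] by rewrite in_itv /= !ltW.
by apply/andP; split; [rewrite -cospi|rewrite -cos0];
  rewrite ltr_cos ?in_itv //= lexx pi_ge0.
Qed.

Lemma cmx_opp (R : realType) (M : 'M[R]_2) : cmx (- M) = -1 *: cmx M.
Proof. by rewrite scaleN1r [LHS]raddfN. Qed.

Unset Implicit Arguments.

Theorem theorem3p9 (R : realType) (N : nat) (f q w : nat -> R)
  (K M : 'M[R]_2) (gamma : R) :
  (2 <= N)%N ->
  (forall n, (n <= N)%N -> f n != 0) ->
  (forall n, (1 <= n <= N)%N -> 0 < w n) ->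
  0 < \prod_(i < N) (f i)^-1 ->
  (- pi < gamma < 0) || (0 < gamma < pi) ->
  \det K = 1 ->
  K 0 0 - f 0 * K 0 1 != 0 ->
  (M = K \/ M = - K) ->
  0 < M 0 0 - f 0 * M 0 1 ->
  exists sM sNM sG sU : seq R,
    [/\ ev_list N f q w (cmx M) (- 1%:M) sM,
        ev_list N f q w (cmx (- M)) (- 1%:M) sNM,
        ev_list N f q w (expi gamma *: cmx M) (- 1%:M) sG
      & ev_list N f q w (UK_A K) (UK_B R) sU] /\
    [/\ (N <= size sM)%N, (N <= size sNM)%N, (N <= size sG)%N
      & (N.-1 <= size sU)%N] /\
    (forall j, (j < N)%N ->
       if ~~ odd j then sM`_j < sG`_j < sNM`_j
       else sNM`_j < sG`_j < sM`_j) /\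
    (forall j, (j.+1 < N)%N ->
       Num.max sM`_j sNM`_j <= sU`_j <= Num.min sM`_j.+1 sNM`_j.+1).
Proof.
case: N => [|[|n]] // _ f_neq0 w_gt0 prod_gt0 gamma_range detK pivotK MK pivot_gt0.
have detM : \det M = 1.
  by case: MK => -> //; rewrite -scaleN1r detZ sqrrN expr1n mul1r.
have pivot_neq0 : pivot f M != 0 by rewrite gt_eqF.
have /andP[lt_NG lt_G1] := Re_expi_bounds gamma_range.
pose s := coupled_eigenvals f q w n.+1 M.
have ev_s z : `|z| = 1 -> ev_list n.+2 f q w (z *: cmx M) (- 1%:M) (s z).
  by move=> z_norm1; apply: ev_list_coupled.
have size_s z : (n.+2 <= size (s z))%N by rewrite size_coupled_eigenvals.
have s_alternate := coupled_eigenvals_alternate q w_gt0 prod_gt0 pivot_gt0.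
have s_interlace := coupled_separated_interlacing f q w M (n := n.+1).
rewrite -/s in s_alternate s_interlace; clearbody s.
exists (s 1), (s (-1)), (s (expi gamma)), (separated_eigenvals f q w n.+1 K).
split; [split|split; [|split=> j lt_jN]].
- by rewrite -[cmx M]scale1r; apply: ev_s; rewrite normr1.
- by rewrite cmx_opp; apply: ev_s; rewrite normrN1.
- exact/ev_s/norm_expi.
- exact: ev_list_separated.
- by rewrite !size_s size_separated_eigenvals.
- have := s_alternate _ _ j (norm_expi gamma) (normr1 _) lt_G1 lt_jN.
  have := s_alternate _ _ j (normrN1 _) (norm_expi gamma) lt_NG lt_jN.
  by case: ifP => _ -> ->.
rewrite (separated_eigenvals_sign f q w n.+1 MK) ge_max le_min.
have /andP[-> ->] := s_interlace 1 j lt_jN.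
by have /andP[-> ->] := s_interlace (-1) j lt_jN.
Qed.
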